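(* Let matrix sets $\mathcal{A}_1,\mathcal{A}_2,\dots,\mathcal{A}_N\subset\mathbb{C}^{n\times n}$ be given. Then: (i) for each $\theta\in\mathbb{R}$ such that at least $N-1$ of the $\mathcal{A}_i$ satisfy the $\theta$-chord property, $$\mathrm{SRG}_\theta\Big(\sum_{i=1}^N\mathcal{A}_i\Big)\subset\sum_{i=1}^N\mathrm{SRG}_\theta(\mathcal{A}_i);$$ (ii) for each sequence $\theta_i\in\mathbb{R}$, $i=1,2,\dots,N$, such that at least $N-1$ of the $\mathcal{A}_i$ satisfy the $\theta_i$-arc property (i.e. $\mathcal{A}_i$ satisfies the $\theta_i$-arc property for at least $N-1$ indices $i$), $$\mathrm{SRG}_{\sum_{i=1}^N\theta_i}\Big(\prod_{i=1}^N\mathcal{A}_i\Big)\subset\prod_{i=1}^N\mathrm{SRG}_{\theta_i}(\mathcal{A}_i).$$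
   Context: $j$ is the imaginary unit, $\langle x,y\rangle=x^Hy$, and $\|\cdot\|$ is the Euclidean norm. For $x,y\in\mathbb{C}^n$ and $\theta\in\mathbb{R}$, $\angle_\theta(x,y)\in[0,\pi]$ is $\arccos\frac{\mathrm{Re}\langle x,e^{-j\theta}y\rangle}{\|x\|\|y\|}$ if $x\neq0,y\neq0$, and $0$ if $x=0$ or $y=0$. The $\theta$-symmetric scaled relative graph of $C\in\mathbb{C}^{n\times n}$ is $$\mathrm{SRG}_\theta(C)=\Big\{\tfrac{\|Cx\|}{\|x\|}\exp\{j(\theta\pm\angle_\theta(x,Cx))\}:0\neq x\in\mathbb{C}^n\Big\}$$ (both signs included), and for a set of matrices $\mathcal{C}$, $\mathrm{SRG}_\theta(\mathcal{C})=\bigcup_{C\in\mathcal{C}}\mathrm{SRG}_\theta(C)$. For $z\in\mathbb{C}$, $\mathrm{Chord}_\theta(z)$ is the closed line segment joining $z$ and its mirror image $\overline{z}e^{2j\theta}$ across the line $e^{j\theta}\mathbb{R}$. $\mathrm{Arc}^+_\theta(z)$ (resp. $\mathrm{Arc}^-_\theta(z)$) is the circular arc centered at the origin joining $z$ and $\overline{z}e^{2j\theta}$ that crosses the ray $e^{j\theta}\mathbb{R}^+$ (resp. $e^{j\theta}\mathbb{R}^-$); i.e., writing $z=|z|e^{j(\theta\pm\psi)}$ with $\psi\in[0,\pi]$, $\mathrm{Arc}^+_\theta(z)=\{|z|e^{j(\theta+\varphi)}:|\varphi|\le\psi\}$ and $\mathrm{Arc}^-_\theta(z)=\{|z|e^{j(\theta+\varphi)}:\psi\le|\varphi|\le\pi\}$.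 A matrix set $\mathcal{C}$ satisfies the $\theta$-chord property if $\mathrm{Chord}_\theta(z)\subset\mathrm{SRG}_\theta(\mathcal{C})$ for all $z\in\mathrm{SRG}_\theta(\mathcal{C})$. It satisfies the $\theta$-arc property if either $\mathrm{Arc}^+_\theta(z)\subset\mathrm{SRG}_\theta(\mathcal{C})$ for all $z\in\mathrm{SRG}_\theta(\mathcal{C})$, or $\mathrm{Arc}^-_\theta(z)\subset\mathrm{SRG}_\theta(\mathcal{C})$ for all $z\in\mathrm{SRG}_\theta(\mathcal{C})$. Sums and products of sets (of matrices, or of complex numbers) are elementwise: $\sum_i\mathcal{A}_i=\{\sum_iA_i:A_i\in\mathcal{A}_i\}$ and $\prod_{i=1}^N\mathcal{A}_i=\{A_1A_2\cdots A_N:A_i\in\mathcal{A}_i\}$. *)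

(* Defs.v *)
From mathcomp Require Import all_boot all_order all_algebra.
From mathcomp Require Import all_classical all_reals all_analysis.
From mathcomp.real_closed Require Import complex.

Set Implicit Arguments.
Unset Strict Implicit.
Unset Printing Implicit Defensive.

Import Order.TTheory GRing.Theory Num.Theory.
Local Open Scope classical_set_scope.
Local Open Scope sesquilinear_scope.
Local Open Scope complex_scope.
Local Open Scope ring_scope.

Definition set_sum (V : nmodType) (N : nat) (A : 'I_N -> set V) : set V :=
  [set \sum_(i < N) a i | a in [set a : 'I_N -> V | forall i, A i (a i)]].

(* The product is ordered by increasing index: a 0 * a 1 * ... * a (N-1). *)
Definition set_prod (S : pzSemiRingType) (N : nat) (A : 'I_N -> set S) : set S :=
  [set \prod_(i < N) a i | a in [set a : 'I_N -> S | forall i, A i (a i)]].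

Section ScaledRelativeGraph.
Variable R : realType.

(* exp (j t) *)
Definition expj (t : R) : R[i] := cos t +i* sin t.

(* <x, y> = x^H y, conjugate-linear in x *)
Definition inner (n : nat) (x y : 'cV[R[i]]_n) : R[i] := (x ^t* *m y) 0 0.

Definition enorm (n : nat) (x : 'cV[R[i]]_n) : R :=
  Num.sqrt (complex.Re (inner x x)).

Definition angle (n : nat) (theta : R) (x y : 'cV[R[i]]_n) : R :=
  if (x == 0) || (y == 0) then 0
  else acos (complex.Re (inner x (expj (- theta) *: y)) / (enorm x * enorm y)).

Definition SRG (n : nat) (theta : R) (C : 'M[R[i]]_n) : set R[i] :=
  [set z | exists x : 'cV[R[i]]_n, x != 0 /\
     let r := (enorm (C *m x) / enorm x)%:C in
     let psi := angle theta x (C *m x) in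
     z = r * expj (theta + psi) \/ z = r * expj (theta - psi)].

Definition SRGset (n : nat) (theta : R) (A : set 'M[R[i]]_n) : set R[i] :=
  \bigcup_(C in A) SRG theta C.

Definition mirror (theta : R) (z : R[i]) : R[i] := z^* * expj (2 * theta).

Definition Chord (theta : R) (z : R[i]) : set R[i] :=
  [set (1 - t)%:C * z + t%:C * mirror theta z | t in [set t : R | 0 <= t <= 1]].

(* psi is the angle with z = |z| exp(j (theta +- psi)); it is unique unless
   z = 0, in which case both arcs are {0} whatever psi is. *)
Definition Arc_plus (theta : R) (z : R[i]) : set R[i] :=
  [set w | exists psi phi : R,
     [/\ 0 <= psi <= pi,
         z = `|z| * expj (theta + psi) \/ z = `|z| * expj (theta - psi),
         `|phi| <= psi
       & w = `|z| * expj (theta + phi)]].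

Definition Arc_minus (theta : R) (z : R[i]) : set R[i] :=
  [set w | exists psi phi : R,
     [/\ 0 <= psi <= pi,
         z = `|z| * expj (theta + psi) \/ z = `|z| * expj (theta - psi),
         psi <= `|phi| <= pi
       & w = `|z| * expj (theta + phi)]].

Definition chord_property (n : nat) (theta : R) (A : set 'M[R[i]]_n) : Prop :=
  forall z, SRGset theta A z -> Chord theta z `<=` SRGset theta A.

Definition arc_property (n : nat) (theta : R) (A : set 'M[R[i]]_n) : Prop :=
  (forall z, SRGset theta A z -> Arc_plus theta z `<=` SRGset theta A) \/
  (forall z, SRGset theta A z -> Arc_minus theta z `<=` SRGset theta A).

End ScaledRelativeGraph.

(* Main.v *)
(** For [x != 0] and [w = exp(-j theta) C x], the points of SRG_theta(C) coming
    from [x] are [exp(j theta) (p +- j h)], where [p] and [h] are the component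
    of [w] along [x] and the norm of its part orthogonal to [x], over |x|, for
    the real inner product [Re <x, y>].  In a sum, [p] is additive and [h] is a
    seminorm, so that the ordinates [h_i] and the ordinate [h] of the sum
    satisfy |h - h_i0| <= sum of the other [h_i]; chords let those other
    ordinates vary in [-h_i, h_i], hence add up to [h - h_i0].
    In a product, the angles along x, A_N x, A_(N-1) A_N x, ... satisfy the
    same polygon inequality, by the triangle inequality on the unit sphere, and
    the arcs [Arc+] play the role of chords.  The arcs [Arc-] reduce to [Arc+]
    because replacing [theta] by [theta + pi] exchanges the two kinds of arcs
    and does not change the scaled relative graph. *)

Require Import Defs.
From mathcomp Require Import all_boot all_order all_algebra.
From mathcomp Require Import all_classical all_reals all_analysis.
From mathcomp.real_closed Require Import complex.
From mathcomp Require Import ring lra.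

Set Implicit Arguments.
Unset Strict Implicit.
Unset Printing Implicit Defensive.

Import Order.TTheory GRing.Theory Num.Theory.
Local Open Scope classical_set_scope.
Local Open Scope complex_scope.
Local Open Scope ring_scope.

(* Stated apart because [field] does not terminate on atoms built with [enorm]. *)
Lemma cos_sum_identity (F : fieldType) (a b c d e f g h : F) :
  a != 0 -> b != 0 -> c != 0 ->
  f - d * e / b ^+ 2 - - (g * h) =
  a * c * (f / (a * c) - (d / (b * a) * (e / (b * c)) - g / a * (h / c))).
Proof. by move=> a0 b0 c0; field; rewrite a0 b0 c0. Qed.

(** * Complex column vectors as a real Euclidean space: projections and angles *)

Section RealInnerProduct.
Variables (R : realType) (n : nat).
Implicit Types (x y z : 'cV[R[i]]_n) (c t : R).

Definition rdot x y : R := complex.Re (inner x y).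

Lemma rdotE x y :
  rdot x y = \sum_k (complex.Re (x k 0) * complex.Re (y k 0)
                     + complex.Im (x k 0) * complex.Im (y k 0)).
Proof.
rewrite /rdot /inner mxE (raddf_sum (@complex.Re R : Rcomplex R -> R)).
apply: eq_bigr => k _; rewrite !mxE.
by case: (x k 0) (y k 0) => [a b] [c d] /=; ring.
Qed.

Lemma rdotC x y : rdot x y = rdot y x.
Proof.
by rewrite !rdotE; apply: eq_bigr => k _; rewrite mulrC [X in _ + X]mulrC.
Qed.

Lemma rdotDl x y z : rdot (x + y) z = rdot x z + rdot y z.
Proof.
rewrite !rdotE -big_split; apply: eq_bigr => k _; rewrite !mxE /=.
by case: (x k 0) (y k 0) (z k 0) => [a b] [c d] [e f] /=; ring.
Qed.

Lemma rdotZl c x y : rdot (c%:C *: x) y = c * rdot x y.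
Proof.
rewrite !rdotE mulr_sumr; apply: eq_bigr => k _; rewrite !mxE /=.
by case: (x k 0) (y k 0) => [a b] [d e] /=; ring.
Qed.

Lemma rdotDr x y z : rdot x (y + z) = rdot x y + rdot x z.
Proof. by rewrite rdotC rdotDl ![rdot _ x]rdotC. Qed.

Lemma rdotZr c x y : rdot x (c%:C *: y) = c * rdot x y.
Proof. by rewrite rdotC rdotZl rdotC. Qed.

Lemma rdotNl x y : rdot (- x) y = - rdot x y.
Proof. by rewrite -scaleN1r -[-1](rmorphN1 (real_complex R)) rdotZl mulN1r. Qed.

Lemma rdotNr x y : rdot x (- y) = - rdot x y.
Proof. by rewrite rdotC rdotNl rdotC. Qed.

Lemma rdot0r x : rdot x 0 = 0.
Proof. by rewrite -(scale0r 0) -[0](rmorph0 (real_complex R)) rdotZr mul0r. Qed.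

Lemma rdot_expj t x y : rdot (expj t *: x) (expj t *: y) = rdot x y.
Proof.
rewrite !rdotE; apply: eq_bigr => k _; rewrite !mxE.
case: (x k 0) (y k 0) => [a b] [c d] /=.
transitivity ((cos t ^+ 2 + sin t ^+ 2) * (a * c + b * d)); first by ring.
by rewrite cos2Dsin2 mul1r.
Qed.

Lemma rdot_ge0 x : 0 <= rdot x x.
Proof. by rewrite rdotE; apply: sumr_ge0 => k _; rewrite addr_ge0 ?sqr_ge0. Qed.

Lemma rdot_eq0 x : (rdot x x == 0) = (x == 0).
Proof.
apply/eqP/eqP => [|->]; last exact: rdot0r.
rewrite rdotE => /eqP; rewrite psumr_eq0 => [|k _]; last by rewrite addr_ge0 ?sqr_ge0.
move=> /allP h; apply/matrixP => k j; rewrite ord1 mxE.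
have := h k (mem_index_enum _); case: (x k 0) => a b /=.
by rewrite paddr_eq0 ?sqr_ge0 // !mulf_eq0 !orbb => /andP[/eqP -> /eqP ->].
Qed.

Lemma rdot_gt0 x : x != 0 -> 0 < rdot x x.
Proof. by rewrite lt0r rdot_ge0 rdot_eq0 => ->. Qed.

Lemma enormE x : enorm x = Num.sqrt (rdot x x).
Proof. by []. Qed.

Local Opaque rdot enorm.

Lemma sqr_enorm x : enorm x ^+ 2 = rdot x x.
Proof. by rewrite enormE sqr_sqrtr ?rdot_ge0. Qed.

Lemma enorm_ge0 x : 0 <= enorm x.
Proof. by rewrite enormE sqrtr_ge0. Qed.

Lemma enorm_gt0 x : x != 0 -> 0 < enorm x.
Proof. by move=> x0; rewrite enormE sqrtr_gt0 rdot_gt0. Qed.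

Lemma enorm0 : enorm (0 : 'cV[R[i]]_n) = 0.
Proof. by rewrite enormE rdot0r sqrtr0. Qed.

Lemma enormN x : enorm (- x) = enorm x.
Proof. by rewrite !enormE rdotNl rdotNr opprK. Qed.

Lemma enorm_expj t x : enorm (expj t *: x) = enorm x.
Proof. by rewrite !enormE rdot_expj. Qed.

(** The component of [y] orthogonal to [x] for the real product [rdot], not the Hermitian one: a
    purely imaginary multiple of [x] is left unchanged. *)
Definition perp x y := y - (rdot x y / rdot x x)%:C *: x.

(** For [z = y] this is Pythagoras; the polarised form supplies the term [cos - cos * cos] of the
    spherical law of cosines needed in [ang_triangle]. *)
Lemma rdot_perp x y z : x != 0 ->
  rdot (perp x y) (perp x z) = rdot y z - rdot x y * rdot x z / rdot x x.
Proof.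
rewrite -rdot_eq0 => x0.
rewrite /perp rdotDl !rdotDr !rdotNl !rdotNr !rdotZl !rdotZr (rdotC y x).
by move: (rdot x x) (rdot y z) (rdot x y) (rdot x z) x0 => a b c d a0; field.
Qed.

Lemma perpD x y z : perp x (y + z) = perp x y + perp x z.
Proof.
by rewrite /perp rdotDr mulrDl rmorphD /= scalerDl opprD addrACA.
Qed.

Lemma perp0 x : perp x 0 = 0.
Proof. by rewrite /perp rdot0r mul0r scale0r subr0. Qed.

Lemma perpN x y : perp x (- y) = - perp x y.
Proof. by rewrite /perp rdotNr mulNr rmorphN /= scaleNr opprB opprK addrC. Qed.

Local Opaque perp.

(** Nonnegativity of the squared norm of [perp x y] is the square of this inequality. *)
Lemma CauchySchwarz x y : `|rdot x y| <= enorm x * enorm y.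
Proof.
have [->|x0] := eqVneq x 0; first by rewrite rdotC rdot0r normr0 mulr_ge0 ?enorm_ge0.
have := rdot_ge0 (perp x y).
rewrite rdot_perp // subr_ge0 ler_pdivrMr ?(rdot_gt0 x0) // -expr2 -!sqr_enorm.
rewrite -exprMn [enorm y * _]mulrC.
move=> le_xy; rewrite -[leRHS]ger0_norm ?mulr_ge0 ?enorm_ge0 //.
by rewrite -ler_sqr ?nnegrE ?normr_ge0 // !real_normK ?num_real.
Qed.

Lemma enormD x y : enorm (x + y) <= enorm x + enorm y.
Proof.
rewrite -ler_sqr ?nnegrE ?addr_ge0 ?enorm_ge0 // sqr_enorm rdotDl !rdotDr.
rewrite sqrrD !sqr_enorm (rdotC y x).
have := le_trans (ler_norm _) (CauchySchwarz x y).
move: (rdot x x) (rdot y y) (rdot x y) (enorm x) (enorm y) => a b c d e; lra.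
Qed.

Lemma enorm_dist x y : `|enorm (x + y) - enorm x| <= enorm y.
Proof.
have le_x : enorm x <= enorm (x + y) + enorm (- y).
  by rewrite -{1}(addrK y x) enormD.
move: le_x (enormD x y); rewrite enormN ler_norml => le_x le_xy.
by rewrite lerBlDl le_xy andbT lerNl opprB lerBlDl.
Qed.

Lemma enorm_sum (I : Type) (s : seq I) (P : pred I) (F : I -> 'cV[R[i]]_n) :
  enorm (\sum_(k <- s | P k) F k) <= \sum_(k <- s | P k) enorm (F k).
Proof.
elim/big_rec2: _ => [|k u v _ le_uv]; first by rewrite enorm0.
by apply: le_trans (enormD _ _) _; rewrite lerD2l.
Qed.

Definition ang x y : R := acos (rdot x y / (enorm x * enorm y)).

Lemma angC x y : ang x y = ang y x.
Proof. by rewrite /ang rdotC mulrC [enorm x * _]mulrC mulrC. Qed.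

Lemma cos_ang_bound x y : x != 0 -> y != 0 ->
  -1 <= rdot x y / (enorm x * enorm y) <= 1.
Proof.
move=> x0 y0; rewrite -ler_norml normrM [`|_^-1|]gtr0_norm; last first.
  by rewrite invr_gt0 mulr_gt0 ?enorm_gt0.
by rewrite ler_pdivrMr ?mulr_gt0 ?enorm_gt0 // mul1r CauchySchwarz.
Qed.

Lemma ang_bound x y : x != 0 -> y != 0 -> 0 <= ang x y <= pi.
Proof. by move=> x0 y0; rewrite acos_ge0 ?acos_lepi ?cos_ang_bound. Qed.

Lemma cos_ang x y : x != 0 -> y != 0 ->
  cos (ang x y) = rdot x y / (enorm x * enorm y).
Proof. by move=> x0 y0; rewrite acosK // in_itv /= cos_ang_bound. Qed.

(** The sine of an arccosine is the nonnegative root of [1 - cos ^+ 2], which Pythagoras for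
    [perp x y] evaluates. *)
Lemma sin_ang x y : x != 0 -> y != 0 ->
  sin (ang x y) = enorm (perp x y) / enorm y.
Proof.
move=> x0 y0; rewrite sin_acos ?cos_ang_bound //.
have h : 0 <= enorm (perp x y) / enorm y by rewrite divr_ge0 ?enorm_ge0.
rewrite -(ger0_norm h) -sqrtr_sqr !expr_div_n exprMn !sqr_enorm rdot_perp //.
congr Num.sqrt; move: x0 y0; rewrite -!rdot_eq0 => x0 y0.
by move: (rdot x x) (rdot y y) (rdot x y) x0 y0 => a b c a0 b0; field; rewrite a0 b0.
Qed.

(* The angle addition formula turns the inequality into Cauchy-Schwarz for
   the components of [x] and [z] orthogonal to [y]. *)
Lemma ang_triangle x y z : x != 0 -> y != 0 -> z != 0 ->
  ang x z <= ang x y + ang y z.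
Proof.
move=> x0 y0 z0.
have /andP[xz0 xzpi] := ang_bound x0 z0.
have /andP[yx0 _] := ang_bound y0 x0.
have /andP[yz0 _] := ang_bound y0 z0.
(* Arguing by contradiction keeps the sum of the two angles below [pi], on the interval where the
   cosine decreases. *)
rewrite (angC x y) leNgt; apply/negP => lt_xz.
suff : cos (ang x z) >= cos (ang y x + ang y z).
  have lt_pi : ang y x + ang y z <= pi by exact: le_trans (ltW lt_xz) xzpi.
  by rewrite leNgt ltr_cos ?lt_xz // in_itv /= ?addr_ge0 ?xz0.
rewrite cosD !cos_ang // !sin_ang //.
have := CauchySchwarz (perp y x) (perp y z); rewrite ler_norml => /andP[+ _].
rewrite rdot_perp // => h.
have nx := enorm_gt0 x0; have ny := enorm_gt0 y0; have nz := enorm_gt0 z0.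
rewrite -subr_ge0 -(pmulr_rge0 _ (mulr_gt0 nx nz)).
move: h; rewrite -(sqr_enorm y) -subr_ge0 => /le_trans; apply.
rewrite le_eqVlt; apply/orP; left; apply/eqP.
by apply: cos_sum_identity; rewrite gt_eqF.
Qed.

End RealInnerProduct.

(** * Complex exponentials of modulus one *)

Section Expj.
Variable R : realType.
Implicit Types (s t : R).

Lemma expjD s t : expj (s + t) = expj s * expj t.
Proof.
by apply/eqP; rewrite eq_complex /= cosD sinD [sin s * _ + _]addrC !eqxx.
Qed.

Lemma expj0 : expj (0 : R) = 1.
Proof. by rewrite /expj cos0 sin0. Qed.

Lemma expj_sum (I : Type) (s : seq I) (F : I -> R) :
  expj (\sum_(i <- s) F i) = \prod_(i <- s) expj (F i).
Proof. exact: (big_morph (@expj R) expjD expj0). Qed.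

Lemma expjNK t : expj t * expj (- t) = 1.
Proof. by rewrite -expjD subrr expj0. Qed.

Lemma expjD2pi t : expj (t + pi + pi) = expj t.
Proof. by rewrite /expj -(addrA t pi pi) -mulr2n cosD2pi sinD2pi. Qed.

Lemma norm_polar (r : R) t : 0 <= r -> `|r%:C * expj t| = r%:C.
Proof.
move=> r0; rewrite normc_def /=; congr (_%:C).
rewrite !mul0r subr0 addr0 !exprMn -mulrDr cos2Dsin2 mulr1 sqrtr_sqr.
exact: ger0_norm.
Qed.

End Expj.

(** * Elementary facts on finite families, shared by the sum and product rules *)

Section Interpolation.
Variables (R : realFieldType) (I : finType).

(** Every bound [h i] is scaled by the same ratio [T / H], of modulus at most 1. The [h i] will be
    half-lengths of chords or half-angles of arcs. *)
Lemma sum_interpolation (P : pred I) (h : I -> R) (T : R) :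
  (forall i, P i -> 0 <= h i) -> `|T| <= \sum_(i | P i) h i ->
  exists2 t : I -> R, forall i, P i -> `|t i| <= h i & \sum_(i | P i) t i = T.
Proof.
move=> h0; set H := \sum_(i | P i) h i => TH.
have H0 : 0 <= H by apply: sumr_ge0.
have [H_eq0|H_neq0] := eqVneq H 0.
  move: TH; rewrite H_eq0 normr_le0 => /eqP ->.
  by exists (fun=> 0); [move=> i /h0; rewrite normr0|exact: big1].
have H_gt0 : 0 < H by rewrite lt0r H_neq0.
exists (fun i => h i * (T / H)); last by rewrite -mulr_suml mulrC divfK.
move=> i /h0 hi; rewrite normrM (ger0_norm hi) ler_piMr //.
by rewrite normf_div (gtr0_norm H_gt0) ler_pdivrMr // mul1r.
Qed.

End Interpolation.

(** Turns the counting hypothesis into a single exceptional index: the complement of [P] has at most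
    one element. If it is empty any index serves, and [0 < N] provides one. *)
Lemma all_but_one (N : nat) (P : pred 'I_N) : (0 < N)%N -> (N - 1 <= #|P|)%N ->
  exists i0, forall i, i != i0 -> P i.
Proof.
case: N P => // N P _ leP.
have [/forallP allP|] := boolP [forall i, P i]; first by exists ord0 => i _.
rewrite negb_forall => /existsP[i0 nPi0]; exists i0 => i; apply: contraNT => nPi.
have : (#|[predC P]| <= 1)%N.
  by rewrite -(leq_add2l #|P|) cardC card_ord addn1 ltnS; move: leP; rewrite subn1.
by move=> /card_le1_eqP eqnP; apply/eqP/eqnP.
Qed.

(** * Cartesian form of the scaled relative graph, and chords *)

Section SRG.
Variables (R : realType) (n : nat).
Implicit Types (x y z : 'cV[R[i]]_n) (C : 'M[R[i]]_n) (A : set 'M[R[i]]_n).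
Implicit Types (theta psi phi p q t : R).

Lemma expj_eq0 t : (expj t == 0) = false.
Proof.
apply/eqP => e; have := expjNK t; rewrite e mul0r => /eqP.
by rewrite eq_sym oner_eq0.
Qed.

Lemma angleE theta x y : x != 0 -> y != 0 ->
  angle theta x y = ang x (expj (- theta) *: y).
Proof.
by move=> /negPf x0 /negPf y0; rewrite /angle /ang x0 y0 enorm_expj.
Qed.

Lemma angle_bound theta x y : 0 <= angle theta x y <= pi.
Proof.
have [x0|x0] := eqVneq x 0; first by rewrite /angle x0 eqxx lexx pi_ge0.
have [y0|y0] := eqVneq y 0; first by rewrite /angle y0 eqxx orbT lexx pi_ge0.
by rewrite angleE // ang_bound // scaler_eq0 expj_eq0.
Qed.

(** Expands [r * expj (theta +- psi)] with the formulas for the cosine and sine of [ang]; [b] is the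
    choice of sign. Unlike modulus and angle, the projection and [perp] are additive in [C]. *)
Lemma SRG_cartesian theta C w : SRG theta C w <->
  exists x, x != 0 /\ exists b : bool,
    let y := expj (- theta) *: (C *m x) in
    w = expj theta * ((rdot x y / rdot x x) +i*
                      ((-1) ^+ b * (enorm (perp x y) / enorm x))).
Proof.
have polar x (b : bool) : x != 0 ->
    (enorm (C *m x) / enorm x)%:C
      * expj (theta + (-1) ^+ b * angle theta x (C *m x)) =
    let y := expj (- theta) *: (C *m x) in
    expj theta * ((rdot x y / rdot x x) +i*
                  ((-1) ^+ b * (enorm (perp x y) / enorm x))).
  move=> x0; cbv zeta; rewrite -[enorm (C *m x)](enorm_expj (- theta)).
  set y := expj _ *: (C *m x).
  (* When [C] kills [x], the angle has its default value 0, which is harmless since both forms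
     vanish. *)
  have [Cx0|Cx0] := eqVneq (C *m x) 0.
    have -> : y = 0 by rewrite /y Cx0 scaler0.
    by rewrite perp0 rdot0r enorm0 !mul0r mulr0 mulr0.
  have y0 : y != 0 by rewrite scaler_eq0 expj_eq0.
  rewrite angleE // expjD mulrCA; congr (_ * _).
  apply/eqP; rewrite eq_complex /= -/y.
  have -> : cos ((-1) ^+ b * ang x y) = cos (ang x y).
    by case: b; rewrite ?expr1 ?mulN1r ?cosN // expr0 mul1r.
  have -> : sin ((-1) ^+ b * ang x y) = (-1) ^+ b * sin (ang x y).
    by case: b; rewrite ?expr1 ?mulN1r ?sinN // expr0 !mul1r.
  rewrite cos_ang // sin_ang // -(sqr_enorm x).
  have nx := enorm_gt0 x0; have ny := enorm_gt0 y0.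
  move: (enorm x) (enorm y) (enorm (perp x y)) (rdot x y) nx ny => a c d e a0 c0.
  by apply/andP; split; apply/eqP; field; rewrite !gt_eqF.
split=> [[x [x0 E]]|[x [x0 [b E]]]]; exists x; split=> //.
  by case: E => ->; [exists false|exists true];
    apply: etrans (polar _ _ x0); rewrite ?expr1 ?expr0 ?mulN1r ?mul1r.
rewrite (etrans E (esym (polar _ _ x0))).
by case: b {E}; rewrite ?expr1 ?expr0 ?mulN1r ?mul1r; [right|left].
Qed.

(** In the frame rotated by [theta] the mirror image is the conjugate, so the chord is the vertical
    segment from [p +i* q] to [p +i* - q]. *)
Lemma chord_fill theta A p q t :
  chord_property theta A -> SRGset theta A (expj theta * (p +i* q)) ->
  `|t| <= `|q| -> SRGset theta A (expj theta * (p +i* t)).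
Proof.
move=> chordA Apq tq; apply: (chordA _ Apq).
(* The point of parameter [u] on the chord has ordinate [(1 - u) * q + u * - q]; solving for [u]
   requires [q] nonzero. *)
have [u [u0 tE]] : exists u : R, 0 <= u <= 1 /\ t = (1 - 2 * u) * q.
  have [q0|q0] := eqVneq q 0.
    move: tq; rewrite q0 normr0 normr_le0 => /eqP ->.
    by exists 0; rewrite lexx ler01 mulr0.
  exists ((1 - t / q) / 2); have : `|t / q| <= 1.
    by rewrite normf_div ler_pdivrMr ?normr_gt0 // mul1r.
  by rewrite ler_norml => /andP[h1 h2]; split; [lra|field].
exists u => //; rewrite tE /mirror.
have -> : 2 * theta = theta + theta by lra.
rewrite expjD.
have -> : ((expj theta * (p +i* q))^* : R[i]) = expj (- theta) * (p +i* - q).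
  rewrite rmorphM; congr (_ * _).
  by rewrite /expj cosN sinN.
rewrite mulrACA [expj (- theta) * expj theta]mulrC expjNK mul1r.
rewrite [(p +i* - q) * _]mulrC.
by apply/eqP; rewrite eq_complex /=; apply/andP; split; apply/eqP; ring.
Qed.

End SRG.

(** * The sum rule *)

Section SumRule.
Variables (R : realType) (n N : nat).

Lemma SRGset_sum (theta : R) (A : 'I_N -> set 'M[R[i]]_n) (i0 : 'I_N) :
  (forall i, i != i0 -> chord_property theta (A i)) ->
  SRGset theta (set_sum A) `<=` set_sum (fun i => SRGset theta (A i)).
Proof.
move=> chordA z [C [a aA <-] /SRG_cartesian[x [x0 [b]]]] /=.
set w := fun i => expj (- theta) *: (a i *m x).
have -> : expj (- theta) *: ((\sum_(i < N) a i) *m x) = \sum_(i < N) w i.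
  by rewrite mulmx_suml scaler_sumr.
set h := fun i => enorm (perp x (w i)) / enorm x.
set p := fun i => rdot x (w i) / rdot x x.
set H := enorm (perp x (\sum_(i < N) w i)) / enorm x => zE.
have Aw i (s : bool) : SRGset theta (A i) (expj theta * (p i +i* ((-1) ^+ s * h i))).
  exists (a i); first exact: aA.
  by apply/SRG_cartesian; exists x; split; [exact: x0|exists s; reflexivity].
have h_ge0 i : 0 <= h i by rewrite divr_ge0 ?enorm_ge0.
have perp_sum (P : pred 'I_N) :
    perp x (\sum_(i | P i) w i) = \sum_(i | P i) perp x (w i).
  exact: (big_morph (perp x) (perpD x) (perp0 x)).
have rest_le : enorm (perp x (\sum_(i | i != i0) w i)) / enorm x
    <= \sum_(i | i != i0) h i.
  by rewrite perp_sum -mulr_suml ler_wpM2r ?invr_ge0 ?enorm_ge0 ?enorm_sum.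
(* Reverse triangle inequality for [perp x] of the whole sum against its [i0] term. The common sign
   puts the point kept for [i0] on the same side as [z]. *)
have dist_le : `|(-1) ^+ b * H - (-1) ^+ b * h i0| <= \sum_(i | i != i0) h i.
  apply: le_trans rest_le; rewrite -mulrBr normrM normr_sign mul1r.
  rewrite /H /h (bigD1 i0) //= perpD.
  set u := perp x _; set v := perp x _.
  rewrite -mulrBl normrM [`|_^-1|]ger0_norm ?invr_ge0 ?enorm_ge0 //.
  by rewrite ler_wpM2r ?invr_ge0 ?enorm_ge0 // enorm_dist.
have [t th t_sum] := sum_interpolation (fun i _ => h_ge0 i) dist_le.
(* Abscissas are untouched; [i0] keeps a point of its own graph, and only the other ordinates move
   along chords. *)
exists (fun i => expj theta * (p i +i* (if i == i0 then (-1) ^+ b * h i0 else t i))).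
  move=> i /=; case: eqVneq => [->|ii0]; first exact: Aw.
  apply: (chord_fill (chordA i ii0) (Aw i false)).
  by rewrite expr0 mul1r (ger0_norm (h_ge0 i)) th.
rewrite zE -mulr_sumr; congr (_ * _); apply/eqP; rewrite eq_complex.
rewrite (raddf_sum (@complex.Re R : Rcomplex R -> R)).
rewrite (raddf_sum (@complex.Im R : Rcomplex R -> R)) /=.
have -> : rdot x (\sum_(i < N) w i) = \sum_(i < N) rdot x (w i).
  exact: (big_morph (rdot x) (rdotDr x) (rdot0r x)).
rewrite mulr_suml eqxx /= (bigD1 i0) //= eqxx.
under eq_bigr => i /negPf -> do [].
by rewrite t_sum addrC subrK.
Qed.

End SumRule.

(** * Half-turns of the axis, and arcs *)

Section Rotation.
Variables (R : realType) (n : nat).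
Implicit Types (theta psi phi : R) (A : set 'M[R[i]]_n) (C : 'M[R[i]]_n).

Lemma expjDpi theta : expj (theta + pi) = - expj theta :> R[i].
Proof. by rewrite /expj cosDpi sinDpi. Qed.

(** The half-turn changes the sign of both [y] and the prefactor. The abscissa is thus preserved,
    while the ordinate, a norm, only has its sign [b] flipped. *)
Lemma SRGDpi theta C : SRG (theta + pi) C = SRG theta C.
Proof.
have e x (b : bool) :
    (let y := expj (- (theta + pi)) *: (C *m x) in
     expj (theta + pi) * ((rdot x y / rdot x x) +i*
                          ((-1) ^+ b * (enorm (perp x y) / enorm x)))) =
    (let y := expj (- theta) *: (C *m x) in
     expj theta * ((rdot x y / rdot x x) +i*
                   ((-1) ^+ (~~ b) * (enorm (perp x y) / enorm x)))).
  cbv zeta; have -> : expj (- (theta + pi)) = - expj (- theta) :> R[i].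
    by apply: oppr_inj; rewrite opprK -expjDpi opprD subrK.
  rewrite expjDpi scaleNr; set y := expj _ *: _.
  rewrite rdotNr perpN enormN signrN !mulNr -mulrN; congr (_ * _).
  by apply/eqP; rewrite eq_complex /= opprK !eqxx.
apply/seteqP; split => z /SRG_cartesian[x [x0 [b ->]]]; apply/SRG_cartesian;
  exists x; split=> //; exists (~~ b); [exact: e|].
by apply/esym; rewrite -[b in RHS]negbK; exact: e.
Qed.

Lemma SRGsetDpi theta A : SRGset (theta + pi) A = SRGset theta A.
Proof. by apply: eq_bigcupr => C _; exact: SRGDpi. Qed.

Lemma SRGsetDpin theta A m : SRGset (theta + pi *+ m) A = SRGset theta A.
Proof.
elim: m => [|m IHm]; first by rewrite mulr0n addr0.
by rewrite mulrSr addrA SRGsetDpi.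
Qed.

(** Measured from the opposite ray, an angular distance [psi] becomes [pi - psi], so being near one
    ray means being far from the other. *)
Lemma Arc_plusDpi theta (z : R[i]) : Arc_plus (theta + pi) z `<=` Arc_minus theta z.
Proof.
move=> w [psi [phi [/andP[psi0 psipi] zE phi_le wE]]].
(* The shift of [phi] by [pi] goes towards the opposite sign, so that the new modulus is
   [pi - |phi|]. *)
exists (pi - psi), (if phi <= 0 then phi + pi else phi - pi); split.
- by rewrite subr_ge0 psipi gerBl.
- case: zE => zE; [right|left]; rewrite {1}zE; congr (_ * _).
    rewrite -[RHS]expjD2pi; congr expj; move: pi => c; ring.
  congr expj; move: pi => c; ring.
- move: phi_le; have [phi0|phi0] := leP phi 0.
    rewrite (ler0_norm phi0) => h; rewrite ger0_norm; last first.
      move: pi psipi => c; lra.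
    move: pi psipi => c psipi; apply/andP; split; lra.
  rewrite (gtr0_norm phi0) => h; rewrite ler0_norm; last first.
    move: pi psipi => c; lra.
  move: pi psipi => c psipi; apply/andP; split; lra.
- rewrite wE; congr (_ * _); case: ifP => _; first by congr expj; move: pi => c; ring.
  rewrite -[RHS]expjD2pi; congr expj; move: pi => c; ring.
Qed.

Definition arc_plus_property theta A :=
  forall z, SRGset theta A z -> Arc_plus theta z `<=` SRGset theta A.

Lemma arc_property_plus theta A : arc_property theta A ->
  exists k : bool, arc_plus_property (theta + pi *+ k) A.
Proof.
case=> arcA; [exists false|exists true] => z; rewrite SRGsetDpin => Az.
  by rewrite mulr0n addr0; exact: arcA.
by apply: subset_trans (arcA _ Az); exact: Arc_plusDpi.
Qed.

Lemma arc_fill theta psi phi (r : R) A : 0 <= r -> 0 <= psi <= pi ->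
  arc_plus_property theta A -> SRGset theta A (r%:C * expj (theta + psi)) ->
  `|phi| <= psi -> SRGset theta A (r%:C * expj (theta + phi)).
Proof.
move=> r0 psi_bound arcA Apsi phi_le; apply: (arcA _ Apsi).
by exists psi, phi; split=> //; rewrite norm_polar //; left.
Qed.

End Rotation.

(** * The product rule *)

Section ProductRule.
Variables (R : realType) (n : nat).
Implicit Types (x y z : 'cV[R[i]]_n) (s t theta : R).

Lemma ang_expj t x y : ang (expj t *: x) (expj t *: y) = ang x y.
Proof. by rewrite /ang rdot_expj !enorm_expj. Qed.

(** Rotating both arguments of the second angle by [- s] turns the three angles into those of one
    triple [x], [u], [v]. All three triangle inequalities are needed to extend a polygon by one
    side. *)
Lemma angle_triangle s t x y z : x != 0 -> y != 0 -> z != 0 ->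
  [/\ angle (s + t) x z <= angle s x y + angle t y z,
      angle s x y <= angle (s + t) x z + angle t y z &
      angle t y z <= angle (s + t) x z + angle s x y].
Proof.
move=> x0 y0 z0; rewrite !angleE //.
rewrite -(ang_expj (- s) y) scalerA -expjD -opprD.
set u := expj (- s) *: y; set v := expj _ *: z.
have u0 : u != 0 by rewrite scaler_eq0 expj_eq0.
have v0 : v != 0 by rewrite scaler_eq0 expj_eq0.
split; first exact: ang_triangle.
  by rewrite (angC u v) ang_triangle.
by rewrite addrC (angC x u) ang_triangle.
Qed.

Local Opaque angle.

(** If the product kills [x], some factor kills the nonzero vector that reaches it; hence 0 lies in
    the graph of that factor. *)
Lemma prod_mulmx_eq0 N (a : 'I_N -> 'M[R[i]]_n) x : x != 0 ->
  (\prod_(i < N) a i) *m x = 0 ->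
  exists i (v : 'cV[R[i]]_n), v != 0 /\ a i *m v = 0.
Proof.
move=> x0; elim: N a => [|N IHN] a.
  by rewrite big_ord0 mul1mx => /eqP; rewrite (negPf x0).
rewrite big_ord_recl -mulmxE -mulmxA.
have [/IHN[i [v [v0 av0]]] _|Bx0 aBx0] := eqVneq ((\prod_(i < N) a (lift ord0 i)) *m x) 0.
  by exists (lift ord0 i), v.
by exists ord0, ((\prod_(i < N) a (lift ord0 i)) *m x).
Qed.

(** Glues the triangle [Psi], [Psi'], [psi ord0] to a polygon along its side [Psi']. Doubling
    [psi i] states that it is at most [Psi] plus the other sides without removing an index from the
    sum. *)
Lemma polygon_recl N (psi : 'I_N.+1 -> R) (Psi Psi' : R) :
  Psi' <= \sum_(i < N) psi (lift ord0 i) ->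
  (forall i, psi (lift ord0 i) *+ 2 <= Psi' + \sum_(i < N) psi (lift ord0 i)) ->
  [/\ Psi <= Psi' + psi ord0, Psi' <= Psi + psi ord0 & psi ord0 <= Psi + Psi'] ->
  Psi <= \sum_(i < N.+1) psi i /\
  forall i, psi i *+ 2 <= Psi + \sum_(i < N.+1) psi i.
Proof.
rewrite big_ord_recl; set S := \sum_(i < N) _ => le_Psi le_psi [le1 le2 le3].
split; first by rewrite addrC (le_trans le1) // lerD2r.
move=> i; rewrite mulr2n; case: (unliftP ord0 i) => [j ->|->].
  have := le_psi j; rewrite mulr2n => /le_trans; apply.
  by rewrite addrA lerD2r.
rewrite [Psi + _]addrCA lerD2l; apply: le_trans le3 _.
by rewrite lerD2l.
Qed.

(* The last two inequalities are the polygon inequality between the angles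
   [angle (theta i) (v i) (a i *m v i)] and the angle of the product. *)
Lemma prod_mulmx_chain N (theta : 'I_N -> R) (a : 'I_N -> 'M[R[i]]_n) x :
  x != 0 -> (\prod_(i < N) a i) *m x != 0 ->
  exists v : 'I_N -> 'cV[R[i]]_n,
    let psi i := angle (theta i) (v i) (a i *m v i) in
    let Psi := angle (\sum_(i < N) theta i) x ((\prod_(i < N) a i) *m x) in
    [/\ forall i, v i != 0,
        enorm ((\prod_(i < N) a i) *m x) / enorm x =
          \prod_(i < N) (enorm (a i *m v i) / enorm (v i)),
        Psi <= \sum_(i < N) psi i &
        forall i, psi i *+ 2 <= Psi + \sum_(i < N) psi i].
Proof.
move=> x0; elim: N theta a => [|N IHN] theta a.
  (* For the empty product, [Psi] is the angle of [x] with itself, namely 0. *)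
  rewrite big_ord0 mul1mx => _; exists (fun=> 0); split; [by case| | |by case].
    by rewrite big_ord0 divff // gt_eqF // enorm_gt0.
  rewrite !big_ord0 angleE // oppr0 expj0 scale1r /ang.
  by rewrite -expr2 sqr_enorm divff ?acos1 // rdot_eq0.
rewrite !big_ord_recl -mulmxE -mulmxA; set B := \prod_(i < N) _.
move=> aBx0; set y := B *m x; set z := a ord0 *m y.
have y0 : y != 0 by apply: contraNneq aBx0 => Bx0; rewrite -/y Bx0 mulmx0.
have [v /= [v0 r_eq le_Psi le_psi]] := IHN (theta \o lift ord0) (a \o lift ord0) y0.
have [le1 le2 le3] :=
  angle_triangle (\sum_(i < N) theta (lift ord0 i)) (theta ord0) x0 y0 aBx0.
(* Factor 0 is applied last, to [y = B *m x], so [y] is put in front of the chain that starts at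
   [x]. *)
have [u [u0 uS]] : exists u : 'I_N.+1 -> 'cV[R[i]]_n,
    u ord0 = y /\ forall i, u (lift ord0 i) = v i.
  exists (fun i => oapp v y (unlift ord0 i)).
  by rewrite unlift_none; split=> // i; rewrite liftK.
exists u.
set psi := fun i => angle (theta i) (u i) (a i *m u i).
set Psi := angle _ x z; cbv zeta.
have psi0 : psi ord0 = angle (theta ord0) y z by rewrite /psi u0.
have psiS i : psi (lift ord0 i) =
    angle (theta (lift ord0 i)) (v i) (a (lift ord0 i) *m v i).
  rewrite /psi uS; reflexivity.
have PsiE : Psi = angle (\sum_(i < N) theta (lift ord0 i) + theta ord0) x z.
  by rewrite /Psi [theta ord0 + _]addrC.
have sum_psi : \sum_(i < N) psi (lift ord0 i) =
    \sum_(i < N) angle (theta (lift ord0 i)) (v i) (a (lift ord0 i) *m v i).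
  by apply: eq_bigr => i _; exact: psiS.
have [le_Psi1 le_psi1] : Psi <= \sum_(i < N.+1) psi i /\
    forall i, psi i *+ 2 <= Psi + \sum_(i < N.+1) psi i.
  apply: (@polygon_recl _ psi Psi (angle (\sum_(i < N) theta (lift ord0 i)) x y)).
  - by rewrite sum_psi; exact: le_Psi.
  - by move=> i; rewrite sum_psi psiS; exact: le_psi.
  - by rewrite PsiE psi0; split; [exact: le1|exact: le2|exact: le3].
split; [| |exact: le_Psi1|exact: le_psi1].
- by move=> i; case: (unliftP ord0 i) => [j|] ->; rewrite ?uS ?u0.
- have y_neq0 : enorm y != 0 := lt0r_neq0 (enorm_gt0 y0).
  rewrite big_ord_recl u0; under eq_bigr => i _ do rewrite uS.
  by rewrite -r_eq mulrA divfK; [reflexivity|exact: y_neq0].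
Qed.

Lemma SRG_polar theta (C : 'M[R[i]]_n) x (b : bool) : x != 0 ->
  SRG theta C ((enorm (C *m x) / enorm x)%:C
               * expj (theta + (-1) ^+ b * angle theta x (C *m x))).
Proof.
move=> x0; exists x; split=> //; case: b.
  by right; rewrite expr1 mulN1r.
by left; rewrite expr0 mul1r.
Qed.

Lemma SRG0 theta (C : 'M[R[i]]_n) x : x != 0 -> C *m x = 0 -> SRG theta C 0.
Proof.
by move=> x0 Cx0; exists x; split=> //; left; rewrite Cx0 enorm0 mul0r mul0r.
Qed.

Lemma SRGset_prod_plus N (theta : 'I_N -> R) (A : 'I_N -> set 'M[R[i]]_n)
    (i0 : 'I_N) :
  (forall i, i != i0 -> arc_plus_property (theta i) (A i)) ->
  SRGset (\sum_(i < N) theta i) (set_prod A) `<=`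
    set_prod (fun i => SRGset (theta i) (A i)).
Proof.
move=> arcA z [C [a aA <-] [x [x0]]] /=.
have [aBx0|aBx0] := eqVneq ((\prod_(i < N) a i) *m x) 0.
  rewrite aBx0 enorm0 !mul0r => zE; have {zE} -> : z = 0 by case: zE.
  have [k [v [v0 av0]]] := prod_mulmx_eq0 x0 aBx0.
  (* One zero factor makes the product zero, so any graph points, here those coming from [x], serve
     for the other factors. *)
  exists (fun i => if i == k then 0 else
    (enorm (a i *m x) / enorm x)%:C
      * expj (theta i + (-1) ^+ false * angle (theta i) x (a i *m x))).
    move=> i /=; exists (a i); first exact: aA.
    by case: eqVneq => [->|_]; [exact: SRG0 v0 av0|exact: (SRG_polar _ _ false x0)].
  by rewrite (bigD1 k) //= eqxx mul0r.
have [v /=] := prod_mulmx_chain theta x0 aBx0.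
set Psi := angle _ x _; set psi := fun i => angle (theta i) (v i) (a i *m v i).
move=> [v0 -> le_Psi le_psi] zE.
have {zE} [b ->] : exists b : bool,
    z = (\prod_(i < N) (enorm (a i *m v i) / enorm (v i)))%:C
        * expj (\sum_(i < N) theta i + (-1) ^+ b * Psi).
  by case: zE => ->; [exists false|exists true];
    rewrite ?expr0 ?expr1 ?mul1r ?mulN1r.
have Av i (s : bool) : SRGset (theta i) (A i)
    ((enorm (a i *m v i) / enorm (v i))%:C * expj (theta i + (-1) ^+ s * psi i)).
  by exists (a i); [exact: aA|exact: SRG_polar].
have psi_bound i : 0 <= psi i <= pi := angle_bound _ _ _.
have psi_ge0 i : i != i0 -> 0 <= psi i by case/andP: (psi_bound i).
(* The polygon inequality for the sides [Psi] and [psi i0] gives the two halves of this bound. *)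
have dist_le : `|(-1) ^+ b * Psi - (-1) ^+ b * psi i0| <= \sum_(i | i != i0) psi i.
  rewrite -mulrBr normrM normr_sign mul1r.
  move: le_Psi (le_psi i0) => {le_psi}; rewrite (bigD1 i0) //= -/(psi i0).
  move: Psi (psi i0) (\sum_(i | i != i0) psi i) => c d e.
  by rewrite mulr2n ler_norml => le1 le2; apply/andP; split; lra.
have [phi le_phi phi_sum] := sum_interpolation psi_ge0 dist_le.
(* Moduli are kept; the angle at [i0] stays extreme and the others move within their arcs to reach
   the required total. *)
pose chi i := if i == i0 then (-1) ^+ b * psi i0 else phi i.
exists (fun i => (enorm (a i *m v i) / enorm (v i))%:C * expj (theta i + chi i)).
  move=> i /=; rewrite /chi; case: eqVneq => [->|ii0]; first exact: Av.
  apply: (arc_fill (psi := psi i)) (arcA i ii0) _ (le_phi i ii0).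
  - by rewrite divr_ge0 ?enorm_ge0.
  - exact: psi_bound.
  - by have := Av i false; rewrite expr0 mul1r.
rewrite big_split /= -expj_sum big_split /= -rmorph_prod; congr (_ * expj (_ + _)).
rewrite (bigD1 i0) //= /chi eqxx.
under eq_bigr => i /negPf -> do [].
by rewrite phi_sum addrC subrK.
Qed.

(** Each factor may use its own kind of arc: its axis is turned by [pi] when needed, and neither its
    graph nor that of the product changes. *)
Lemma SRGset_prod N (theta : 'I_N -> R) (A : 'I_N -> set 'M[R[i]]_n) (i0 : 'I_N) :
  (forall i, i != i0 -> arc_property (theta i) (A i)) ->
  SRGset (\sum_(i < N) theta i) (set_prod A) `<=`
    set_prod (fun i => SRGset (theta i) (A i)).
Proof.
move=> arcA.
(* At [i0] no arcs are available, and its axis is simply left in place. *)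
have /choice[k arcAk] i : exists k : bool,
    i != i0 -> arc_plus_property (theta i + pi *+ k) (A i).
  have [->|ii0] := eqVneq i i0; first by exists false.
  by have [k kP] := arc_property_plus (arcA i ii0); exists k.
have sumE : \sum_(i < N) (theta i + pi *+ k i) =
    \sum_(i < N) theta i + pi *+ (\sum_(i < N) k i)%N.
  by rewrite big_split /= sumrMnr.
move=> z Az; have : SRGset (\sum_(i < N) (theta i + pi *+ k i)) (set_prod A) z.
  by rewrite sumE; move: Az; rewrite -(SRGsetDpin _ _ (\sum_(i < N) k i)%N).
move=> /(SRGset_prod_plus arcAk)[c cA cz]; exists c; last exact: cz.
by move=> i; rewrite -(SRGsetDpin _ _ (k i)); exact: cA.
Qed.

End ProductRule.

Theorem theorem3 (R : realType) (n N : nat) (hN : (0 < N)%N)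
    (A : 'I_N -> set 'M[R[i]]_n) :
  (forall theta : R,
     (N - 1 <= #|[pred i : 'I_N | `[< chord_property theta (A i) >]]|)%N ->
     SRGset theta (set_sum A) `<=` set_sum (fun i : 'I_N => SRGset theta (A i)))
  /\
  (forall theta : 'I_N -> R,
     (N - 1 <= #|[pred i : 'I_N | `[< arc_property (theta i) (A i) >]]|)%N ->
     SRGset (\sum_(i < N) theta i) (set_prod A) `<=`
       set_prod (fun i : 'I_N => SRGset (theta i) (A i))).
Proof.
split=> theta /all_but_one => /(_ hN)[i0 Ai0].
  by apply: (@SRGset_sum _ _ _ theta A i0) => i /Ai0 /asboolP.
by apply: (@SRGset_prod _ _ _ theta A i0) => i /Ai0 /asboolP.
Qed.
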